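(* The constraint $$a_{j,1}^c\le a_{j+1,1}^c,\qquad j\in\{1,\dots,P^c-1\},\quad c\in\{+,-\},$$ where $a_{j,1}^c$ is the first coordinate of $\bm{a}_j^c\in\mathbb{R}^d$, is a valid tightening constraint of the mixed-integer linear problem $MILP1(Q)$: adding it to $MILP1(Q)$ does not change the set of CPWL solutions $f$ represented by the feasible solutions.
   Context: Let $S=(\bm{x}_i,z_i)_{i=1,\dots,N}$ be a set of $N\ge d+1$ points of $\mathbb{R}^{d+1}$ with $(\bm{x}_i)$ in general position in $\mathbb{R}^d$ (any $d+1$ of them affinely independent), $D$ the convex hull of $\{\bm{x}_1,\dots,\bm{x}_N\}$, $\varepsilon\ge 0$, and $P^+,P^-\ge 1$ integers. $MILP1(Q)$ is the problem of minimizing a linear objective $Q$ over continuous variables $\bm{a}_j^c=(a_{j,1}^c,\dots,a_{j,d}^c)^T\in\mathbb{R}^d$, $b_j^c\in\mathbb{R}$ ($j\in\{1,\dots,P^c\}$, $c\in\{+,-\}$), $f(\bm{x}_i),f^+(\bm{x}_i),f^-(\bm{x}_i),e_i\in\mathbb{R}$ and binary variables $\delta_{i,j}^c\in\{0,1\}$, subject to, for all $i\in\{1,\dots,N\}$, $c\in\{+,-\}$, $j\in\{1,\dots,P^c\}$: $f(\bm{x}_i)=f^+(\bm{x}_i)-f^-(\bm{x}_i)$; $0\le f^c(\bm{x}_i)-{\bm{a}_j^c}^T\bm{x}_i-b_j^c$; $f^c(\bm{x}_i)-{\bm{a}_j^c}^T\bm{x}_i-b_j^c\le M_i^c(1-\delta_{i,j}^c)$;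 $\sum_{j=1}^{P^c}\delta_{i,j}^c\ge 1$; $-e_i\le f(\bm{x}_i)-z_i\le e_i$; $0\le e_i\le\varepsilon$. Here the big-M parameters $M_i^c$ are assumed large enough that the constraint containing them is not restrictive when $\delta_{i,j}^c=0$. A feasible solution represents the CPWL function (CPWL solution) $f=f^+-f^-$ on $D$ with $f^c(\bm{x})=\max_{j\in\{1,\dots,P^c\}}f_j^c(\bm{x})$, $f_j^c(\bm{x})={\bm{a}_j^c}^T\bm{x}+b_j^c$. *)

(* Defs.v *)
From mathcomp Require Import all_boot all_order all_algebra.
From mathcomp Require Import all_classical all_reals.
Set Implicit Arguments.
Unset Strict Implicit.
Unset Printing Implicit Defensive.
Import Order.TTheory GRing.Theory Num.Theory.
Local Open Scope classical_set_scope.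
Local Open Scope ring_scope.

Definition affinely_independent (R : realType) (d n : nat)
    (y : 'I_n -> 'cV[R]_d) : Prop :=
  forall l : 'I_n -> R,
    \sum_i l i = 0 -> \sum_i l i *: y i = 0 -> forall i, l i = 0.

Definition general_position (R : realType) (d N : nat)
    (x : 'I_N -> 'cV[R]_d) : Prop :=
  forall s : 'I_d.+1 -> 'I_N, injective s -> affinely_independent (x \o s).

Definition hull (R : realType) (d N : nat) (x : 'I_N -> 'cV[R]_d) :
    set 'cV[R]_d :=
  [set y | exists l : 'I_N -> R,
     [/\ forall i, 0 <= l i, \sum_i l i = 1 & y = \sum_i l i *: x i]].

(* Throughout, the superscript c in {+,-} is a boolean: + is true, - is false. *)

(* Binary variables are stored as reals, as the objective is linear in all the
   variables; integrality is one of the constraints of [milp1_feasible]. *)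
Record milp1_vars (R : realType) (d N : nat) (P : bool -> nat) := MILP1Vars {
  va : forall c, 'I_(P c) -> 'cV[R]_d;
  vb : forall c, 'I_(P c) -> R;
  vf : 'I_N -> R;
  vfc : bool -> 'I_N -> R;
  ve : 'I_N -> R;
  vdelta : forall c, 'I_N -> 'I_(P c) -> R
}.

Definition affine (R : realType) (d : nat) (a : 'cV[R]_d) (b : R)
    (y : 'cV[R]_d) : R :=
  (a^T *m y) 0 0 + b.

(* An arbitrary linear form in the variables [s]; its coefficients [q] are
   indexed exactly as the variables are. *)
Definition linear_objective (R : realType) (d N : nat) (P : bool -> nat)
    (q s : milp1_vars R d N P) : R :=
    \sum_c \sum_(j < P c)
      (\sum_(k < d) va q j k 0 * va s j k 0 + vb q j * vb s j)
  + \sum_i (vf q i * vf s i + ve q i * ve s i)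
  + \sum_c \sum_i
      (vfc q c i * vfc s c i + \sum_(j < P c) vdelta q i j * vdelta s i j).

(* [M c i] may be any extended real. As +oo * 0 = 0 in [\bar R], the value +oo
   makes [feas_bigM] unrestrictive when delta = 0, which no finite value does in
   general, the variables [va] and [vb] being unbounded. *)
Record milp1_feasible (R : realType) (d N : nat) (P : bool -> nat)
    (x : 'I_N -> 'cV[R]_d) (z : 'I_N -> R) (eps : R)
    (M : bool -> 'I_N -> \bar R) (s : milp1_vars R d N P) : Prop := {
  feas_diff : forall i, vf s i = vfc s true i - vfc s false i;
  feas_above : forall i c (j : 'I_(P c)),
    0 <= vfc s c i - affine (va s j) (vb s j) (x i);
  feas_bigM : forall i c (j : 'I_(P c)),
    ((vfc s c i - affine (va s j) (vb s j) (x i))%:E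
      <= M c i * (1 - vdelta s i j)%:E)%E;
  feas_active : forall i c, 1 <= \sum_(j < P c) vdelta s i j;
  feas_error : forall i, - ve s i <= vf s i - z i <= ve s i;
  feas_eps : forall i, 0 <= ve s i <= eps;
  feas_binary : forall i c (j : 'I_(P c)),
    vdelta s i j = 0 \/ vdelta s i j = 1
}.

Record min_problem (R : realType) (V : Type) := MinProblem {
  objective : V -> R;
  feasible : set V
}.

Definition milp1 (R : realType) (d N : nat) (P : bool -> nat)
    (x : 'I_N -> 'cV[R]_d) (z : 'I_N -> R) (eps : R)
    (M : bool -> 'I_N -> \bar R) (q : milp1_vars R d N P) :
    min_problem R (milp1_vars R d N P) :=
  MinProblem (linear_objective q) [set s | milp1_feasible x z eps M s].

Definition add_constraint (R : realType) (V : Type) (p : min_problem R V)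
    (C : set V) : min_problem R V :=
  MinProblem (objective p) (feasible p `&` C).

Definition cpwl_part (R : realType) (d N : nat) (P : bool -> nat)
    (hP : forall c, (0 < P c)%N) (s : milp1_vars R d N P) (c : bool)
    (y : 'cV[R]_d) : R :=
  let piece (j : 'I_(P c)) := affine (va s j) (vb s j) y in
  \big[Num.max/piece (Ordinal (hP c))]_(j < P c) piece j.

Definition cpwl (R : realType) (d N : nat) (P : bool -> nat)
    (x : 'I_N -> 'cV[R]_d) (hP : forall c, (0 < P c)%N)
    (s : milp1_vars R d N P) : hull x -> R :=
  fun y => cpwl_part hP s true (\val y) - cpwl_part hP s false (\val y).

Arguments cpwl {R d N P} x hP s y.

Definition cpwl_solutions (R : realType) (d N : nat) (P : bool -> nat)
    (x : 'I_N -> 'cV[R]_d) (hP : forall c, (0 < P c)%N)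
    (p : min_problem R (milp1_vars R d N P)) : set (hull x -> R) :=
  [set cpwl x hP s | s in feasible p].

Arguments cpwl_solutions {R d N P} x hP p.

Definition valid_tightening (R : realType) (d N : nat) (P : bool -> nat)
    (x : 'I_N -> 'cV[R]_d) (hP : forall c, (0 < P c)%N)
    (p : min_problem R (milp1_vars R d N P)) (C : set (milp1_vars R d N P)) :
    Prop :=
  cpwl_solutions x hP (add_constraint p C) = cpwl_solutions x hP p.

Definition sorted_first_coordinate (R : realType) (d N : nat)
    (P : bool -> nat) (hd : (0 < d)%N) : set (milp1_vars R d N P) :=
  [set s | forall c (j j' : 'I_(P c)), j' = j.+1 :> nat ->
     va s j (Ordinal hd) 0 <= va s j' (Ordinal hd) 0].

(* Main.v *)
Require Import Defs.
From mathcomp Require Import all_boot all_order all_algebra.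
From mathcomp Require Import fingroup perm.
From mathcomp Require Import all_classical all_reals.
Import Order.TTheory.
Local Open Scope ring_scope.

(** For each sign [c], the index of an affine piece is only a label: the constraints treat all
    pieces alike, the bound [M c i] does not depend on the piece, and a maximum ignores the order of
    its arguments. So relabelling the pieces of a feasible point keeps it feasible
    ([permute_pieces_feasible]) and keeps its function ([cpwl_permute_pieces]). Relabelling by a
    permutation from [sorting_perm] meets the new constraint; the converse inclusion only drops a
    constraint. *)

Lemma sorting_perm (disp : Order.disp_t) (T : orderType disp) (n : nat)
    (f : 'I_n -> T) :
  exists p : 'S_n, forall j j' : 'I_n, j' = j.+1 :> nat ->
    (f (p j) <= f (p j'))%O.
Proof.
pose leT i j := (f i <= f j)%O.
have /tuple_permP[p Ep] : perm_eq (sort leT (enum 'I_n)) (ord_tuple n).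
  by rewrite perm_sort perm_refl.
exists p => j j' jj'.
have : sorted leT (sort leT (enum 'I_n)).
  by apply: sort_sorted => i k; exact: le_total.
(* The permutation [p] lists the indices in sorted order. The default [p j] is arbitrary, as [i] is
   within range. *)
have nth_p (i : 'I_n) :
    nth (p j) [tuple tnth (ord_tuple n) (p k) | k < n] i = p i.
  by rewrite -tnth_nth tnth_mktuple tnth_ord_tuple.
rewrite Ep => /(sortedP (p j)) /(_ j).
by rewrite size_tuple -jj' !nth_p; apply.
Qed.

(** The seeds may differ, so reindexing alone does not suffice; but each seed is one of the values,
    so each side bounds all the values of the other. *)
Lemma bigmax_perm (disp : Order.disp_t) (T : orderType disp) (n : nat)
    (f : 'I_n -> T) (p : 'S_n) (i0 : 'I_n) :
  \big[Order.max/f (p i0)]_(j < n) f (p j) = \big[Order.max/f i0]_(j < n) f j.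
Proof.
apply/le_anti/andP; split; apply: bigmax_le => [|j _]; try exact: le_bigmax.
  by rewrite -(permKV p i0) (le_bigmax _ (f \o p)).
by rewrite -(permKV p j) (le_bigmax _ (f \o p)).
Qed.

Definition permute_pieces (R : realType) (d N : nat) (P : bool -> nat)
    (p : forall c, 'S_(P c)) (s : milp1_vars R d N P) : milp1_vars R d N P :=
  MILP1Vars (fun c j => va s (p c j)) (fun c j => vb s (p c j))
    (vf s) (vfc s) (ve s) (fun c i j => vdelta s i (p c j)).

Arguments permute_pieces {R d N P} p s.

(** The selectors move with their pieces, so each constraint at [j] is the old one at [p c j]; only
    the sum in [feas_active] has to be reindexed. *)
Lemma permute_pieces_feasible (R : realType) (d N : nat) (P : bool -> nat)
    (x : 'I_N -> 'cV[R]_d) (z : 'I_N -> R) (eps : R)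
    (M : bool -> 'I_N -> \bar R) (p : forall c, 'S_(P c))
    (s : milp1_vars R d N P) :
  milp1_feasible x z eps M s ->
  milp1_feasible x z eps M (permute_pieces p s).
Proof.
case=> ? ? ? active ? ? ?.
split=> //= i c.
by have := active i c; rewrite (reindex_inj (@perm_inj _ (p c))).
Qed.

Lemma cpwl_permute_pieces (R : realType) (d N : nat) (P : bool -> nat)
    (x : 'I_N -> 'cV[R]_d) (hP : forall c, (0 < P c)%N)
    (p : forall c, 'S_(P c)) (s : milp1_vars R d N P) :
  cpwl x hP (permute_pieces p s) = cpwl x hP s.
Proof.
apply/funext => y; rewrite /cpwl /cpwl_part /=.
by congr (_ - _);
  exact: (bigmax_perm _ _ _ (fun j => affine (va s j) (vb s j) (\val y))).
Qed.

Theorem theorem3 (R : realType) (d N : nat) (hd : (0 < d)%N)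
    (hN : (d.+1 <= N)%N) (x : 'I_N -> 'cV[R]_d) (z : 'I_N -> R)
    (hx : general_position x) (eps : R) (heps : 0 <= eps)
    (P : bool -> nat) (hP : forall c : bool, (0 < P c)%N)
    (M : bool -> 'I_N -> \bar R) (Q : milp1_vars R d N P) :
  valid_tightening x hP (milp1 x z eps M Q)
    (@sorted_first_coordinate R d N P hd).
Proof.
apply/seteqP; split=> _ [s feas_s <-].
  by case: feas_s => feas_s _; exists s.
pose first_coord c (j : 'I_(P c)) := va s j (Ordinal hd) 0.
(* Choice is needed here: the permutations enter the new point as data, one for each sign. *)
pose sorting c := cid (sorting_perm _ _ _ (first_coord c)).
exists (permute_pieces (fun c => sval (sorting c)) s).
  split; first exact: permute_pieces_feasible.
  by move=> c; exact: (svalP (sorting c)).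
exact: cpwl_permute_pieces.
Qed.
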